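(* Let $B\in\mathbb R^{m\times n}$, $D\in\mathbb R^{p\times m}$, $f\in\mathbb R^n$, $h\in\mathbb R^p$, and consider the equality-constrained least squares (LSE) problem $\min_y\|f-B^Ty\|_2$ subject to $Dy=h$, with augmented system $$\begin{bmatrix} I_n & B^T & 0 \\ B & 0 & D^T \\ 0 & D & 0 \end{bmatrix}\begin{bmatrix} r \\ y \\ \lambda \end{bmatrix}=\begin{bmatrix} f \\ 0 \\ h \end{bmatrix}.$$ Let $[\tilde r^T,\tilde y^T,\tilde\lambda^T]^T$, with $\tilde r\in\mathbb R^n$, $\tilde y\in\mathbb R^m$, $\tilde\lambda\in\mathbb R^p$, be an approximate solution of the augmented system (i.e. any given vector; $\tilde y$ is then regarded as an approximate solution of the LSE problem), and let $\alpha_1,\alpha_2,\alpha_3,\alpha_4>0$. Define $\mathcal J_{\mathcal G}\in\mathbb R^{(n+m+p)\times s}$, $s=mn+mp+n+p$, by $$\mathcal J_{\mathcal G}=\begin{bmatrix} \frac1{\alpha_1}\mathcal N^n_{\tilde y}\Phi_B & 0 & -\frac1{\alpha_3}I_n & 0 \\ \frac1{\alpha_1}\mathcal M^m_{\tilde r}\Phi_B & \frac1{\alpha_2}\mathcal N^m_{\tilde\lambda}\Phi_D & 0 & 0 \\ 0 & \frac1{\alpha_2}\mathcal M^p_{\tilde y}\Phi_D & 0 & -\frac1{\alpha_4}I_p \end{bmatrix},$$ and $\widehat R=[\widehat R_f^T,\widehat R_g^T,\widehat R_h^T]^T$ with $\widehat R_f=f-\tilde r-B^T\tilde y$, $\widehat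 R_g=-B\tilde r-D^T\tilde\lambda$, $\widehat R_h=h-D\tilde y$. If $$\mathrm{rank}(\mathcal J_{\mathcal G})=\mathrm{rank}\left([\mathcal J_{\mathcal G}\;\;\widehat R]\right),$$ then the sparsity-preserving backward error of the LSE problem is $$\eta^{LSE}_{\rm sps}(\tilde y)=\left\|\mathcal J_{\mathcal G}^{\dagger}\widehat R\right\|_2,$$ where $\dagger$ denotes the Moore–Penrose inverse.
   Context: Notation. $\odot$ is the Hadamard (entrywise) product. For a real matrix $X=[x_{ij}]$, $\Theta_X$ is the matrix of the same size whose $(i,j)$ entry is $1$ if $x_{ij}\ne0$ and $0$ if $x_{ij}=0$. $\mathrm{vec}(X)$ stacks the columns of $X$, and $\Phi_X=\mathrm{diag}(\mathrm{vec}(\Theta_X))$ for $X\in\{B,D\}$. For $x\in\mathbb R^{b}$, $\mathcal M^{a}_x=[x_1I_a\;x_2I_a\;\cdots\;x_bI_a]\in\mathbb R^{a\times ab}$. For $y\in\mathbb R^{a}$, $\mathcal N^{b}_y\in\mathbb R^{b\times ab}$ is the block diagonal matrix with $b$ diagonal blocks each equal to the row $y^T$. Backward error. $\mathcal G$ is the set of tuples $(\Delta B,\Delta D,\Delta f,\Delta h)$ with $\Delta B\in\mathbb R^{m\times n}$, $\Delta D\in\mathbb R^{p\times m}$, $\Delta f\in\mathbb R^n$, $\Delta h\in\mathbb R^p$ such that $$\begin{bmatrix} I_n & (B+\Delta B)^T & 0 \\ B+\Delta B & 0 & (D+\Delta D)^T \\ 0 & D+\Delta D & 0 \end{bmatrix}\begin{bmatrix}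 \tilde r \\ \tilde y \\ \tilde\lambda \end{bmatrix}=\begin{bmatrix} f+\Delta f \\ 0 \\ h+\Delta h \end{bmatrix}.$$ $\eta^{LSE}_{\rm sps}(\tilde y)$ is the minimum of $\left(\alpha_1^2\|\Delta B\|_F^2+\alpha_2^2\|\Delta D\|_F^2+\alpha_3^2\|\Delta f\|_2^2+\alpha_4^2\|\Delta h\|_2^2\right)^{1/2}$ over all tuples in $\mathcal G$ preserving the sparsity pattern, i.e. $\Delta B=\Delta B\odot\Theta_B$ and $\Delta D=\Delta D\odot\Theta_D$. *)

(* Defs.v *)
From HB Require Import structures.
From mathcomp Require Import all_boot all_order all_algebra.
From mathcomp Require Import boolp classical_sets reals.

Set Implicit Arguments.
Unset Strict Implicit.
Unset Printing Implicit Defensive.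

Import Order.TTheory GRing.Theory Num.Theory.

Local Open Scope classical_set_scope.
Local Open Scope ring_scope.

(* The Frobenius norm; on a column vector it is the Euclidean norm (the
   library's norm on matrices is the max norm). *)
Definition fnorm {R : realType} {m n : nat} (A : 'M[R]_(m, n)) : R :=
  Num.sqrt (\sum_(i < m) \sum_(j < n) A i j ^+ 2).

Definition is_minimum {R : realType} (E : set R) (x : R) : Prop :=
  E x /\ lbound E x.

Definition penrose {R : realType} {m n : nat}
    (A : 'M[R]_(m, n)) (X : 'M[R]_(n, m)) : Prop :=
  [/\ A *m X *m A = A, X *m A *m X = X,
      (A *m X)^T = A *m X & (X *m A)^T = X *m A].

(* The default value 0 is never used: see pinvP and penrose_unique. *)
Definition pinv {R : realType} {m n : nat} (A : 'M[R]_(m, n)) : 'M[R]_(n, m) :=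
  xget 0 [set X | penrose A X].

Section PinvTheory.
Context {R : realType}.

Lemma gram_eq0 m n (A : 'M[R]_(m, n)) : A *m A^T = 0 -> A = 0.
Proof.
move=> /matrixP A0; apply/matrixP => i j; rewrite mxE.
have := A0 i i; rewrite !mxE => /eqP; rewrite psumr_eq0; last first.
  by move=> k _; rewrite mxE -expr2 sqr_ge0.
move=> /allP/(_ j); rewrite mem_index_enum => /(_ isT) /=.
by rewrite mxE -expr2 sqrf_eq0 => /eqP.
Qed.

Lemma gram_unit m n (A : 'M[R]_(m, n)) : row_free A -> A *m A^T \in unitmx.
Proof.
move=> Af; rewrite -row_free_unit -kermx_eq0; apply/eqP.
set K := kermx _; have K0 : K *m (A *m A^T) = 0 by exact: mulmx_ker.
apply: (row_free_inj Af); rewrite mul0mx; apply: gram_eq0.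
by rewrite trmx_mul mulmxA -(mulmxA K) K0 mul0mx.
Qed.

Lemma penrose_exists m n (A : 'M[R]_(m, n)) : exists X, penrose A X.
Proof.
have [k [C [F [AE Cf Ff]]]] : exists k (C : 'M[R]_(m, k)) (F : 'M[R]_(k, n)),
    [/\ A = C *m F, row_full C & row_free F].
  exists (\rank A), (col_base A), (row_base A).
  by rewrite mulmx_base col_base_full row_base_free.
have uF : F *m F^T \in unitmx by exact: gram_unit.
have uC : C^T *m C \in unitmx.
  rewrite -{2}[C]trmxK; apply: gram_unit.
  by rewrite /row_free mxrank_tr; exact: Cf.
pose P := F^T *m invmx (F *m F^T); pose Q := invmx (C^T *m C) *m C^T.
have FP : F *m P = 1%:M by rewrite mulmxA mulmxV.
have QC : Q *m C = 1%:M by rewrite -mulmxA mulVmx.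
have AX : A *m (P *m Q) = C *m Q.
  by rewrite AE mulmxA -(mulmxA C) FP mulmx1.
have XA : P *m Q *m A = P *m F.
  by rewrite AE -mulmxA (mulmxA Q) QC mul1mx.
exists (P *m Q); split.
- by rewrite AX AE mulmxA -(mulmxA C) QC mulmx1.
- by rewrite XA mulmxA -(mulmxA P) FP mulmx1.
- by rewrite AX /Q !trmx_mul trmx_inv trmx_mul !trmxK mulmxA.
- by rewrite XA /P !trmx_mul trmx_inv trmx_mul !trmxK mulmxA.
Qed.

Lemma pinvP m n (A : 'M[R]_(m, n)) : penrose A (pinv A).
Proof. exact: (xgetPex 0 (penrose_exists A)). Qed.

Lemma penrose_unique m n (A : 'M[R]_(m, n)) (X Y : 'M[R]_(n, m)) :
  penrose A X -> penrose A Y -> X = Y.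
Proof.
move=> [AX XA sX tX] [AY YA sY tY].
have AXY : A *m X = A *m Y.
  by rewrite -sX -{1}AY -[A *m Y *m A *m X]mulmxA trmx_mul sX sY mulmxA AX.
have XAY : X *m A = Y *m A.
  rewrite -tX -{1}AY -[A *m Y *m A]mulmxA mulmxA trmx_mul tX tY.
  by rewrite -mulmxA (mulmxA A) AX.
by rewrite -XA XAY -mulmxA AXY mulmxA YA.
Qed.

End PinvTheory.

Section Pattern.
Context {R : realType}.

Definition hadamard m n (A B : 'M[R]_(m, n)) : 'M[R]_(m, n) := map2_mx *%R A B.

Definition Theta m n (X : 'M[R]_(m, n)) : 'M[R]_(m, n) :=
  \matrix_(i, j) (X i j != 0)%:R.

(* mxvec is row-major, so the column-major vec(X) is mxvec X^T. *)
Definition Phi m n (X : 'M[R]_(m, n)) : 'M[R]_(n * m) :=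
  diag_mx (mxvec (Theta X)^T).

(* The columns of the next two matrices split into b blocks of width a; row i
   is the mxvec of the b x a matrix whose (j, k) entry is the k-th entry of
   that row in block j. *)

(* Block j is x_j I_a. *)
Definition Mmx (a b : nat) (x : 'cV[R]_b) : 'M[R]_(a, b * a) :=
  \matrix_(i < a) mxvec (\matrix_(j < b, k < a) (x j 0 *: 1%:M : 'M[R]_a) i k).

(* Block j has row i equal to y^T if i = j and to 0 otherwise. *)
Definition Nmx (a b : nat) (y : 'cV[R]_a) : 'M[R]_(b, b * a) :=
  \matrix_(i < b)
    mxvec (\matrix_(j < b, k < a) (if i == j then y^T 0 k else 0)).

End Pattern.
Arguments Mmx {R} a {b} x.
Arguments Nmx {R a} b y.

Section LSE.
Context {R : realType} {m n p : nat}.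

Definition aug_mx (B : 'M[R]_(m, n)) (D : 'M[R]_(p, m)) :
    'M[R]_(n + (m + p), n + (m + p)) :=
  col_mx (row_mx 1%:M (row_mx B^T 0))
 (col_mx (row_mx B    (row_mx 0   D^T))
         (row_mx 0    (row_mx D   0))).

Definition vec3 (u : 'cV[R]_n) (v : 'cV[R]_m) (w : 'cV[R]_p) :
    'cV[R]_(n + (m + p)) :=
  col_mx u (col_mx v w).

Definition perturbation : Type :=
  ('M[R]_(m, n) * 'M[R]_(p, m) * 'cV[R]_n * 'cV[R]_p)%type.

Definition Gset (B : 'M[R]_(m, n)) (D : 'M[R]_(p, m))
    (f : 'cV[R]_n) (h : 'cV[R]_p)
    (r : 'cV[R]_n) (y : 'cV[R]_m) (l : 'cV[R]_p) : set perturbation :=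
  [set t | let: (dB, dD, df, dh) := t in
    aug_mx (B + dB) (D + dD) *m vec3 r y l = vec3 (f + df) 0 (h + dh)].

Definition preserves_sparsity (B : 'M[R]_(m, n)) (D : 'M[R]_(p, m)) :
    set perturbation :=
  [set t | let: (dB, dD, _, _) := t in
    dB = hadamard dB (Theta B) /\ dD = hadamard dD (Theta D)].

Definition pert_size (a1 a2 a3 a4 : R) (t : perturbation) : R :=
  let: (dB, dD, df, dh) := t in
  Num.sqrt (a1 ^+ 2 * fnorm dB ^+ 2 + a2 ^+ 2 * fnorm dD ^+ 2
          + a3 ^+ 2 * fnorm df ^+ 2 + a4 ^+ 2 * fnorm dh ^+ 2).

Definition sps_sizes (a1 a2 a3 a4 : R) (B : 'M[R]_(m, n)) (D : 'M[R]_(p, m))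
    (f : 'cV[R]_n) (h : 'cV[R]_p)
    (r : 'cV[R]_n) (y : 'cV[R]_m) (l : 'cV[R]_p) : set R :=
  pert_size a1 a2 a3 a4 @`
    (Gset B D f h r y l `&` preserves_sparsity B D).

(* An infimum, so as to be total; it is the backward error only when it is a
   minimum of sps_sizes. *)
Definition eta_sps (a1 a2 a3 a4 : R) (B : 'M[R]_(m, n)) (D : 'M[R]_(p, m))
    (f : 'cV[R]_n) (h : 'cV[R]_p)
    (r : 'cV[R]_n) (y : 'cV[R]_m) (l : 'cV[R]_p) : R :=
  inf (sps_sizes a1 a2 a3 a4 B D f h r y l).

Definition J_G (a1 a2 a3 a4 : R) (B : 'M[R]_(m, n)) (D : 'M[R]_(p, m))
    (r : 'cV[R]_n) (y : 'cV[R]_m) (l : 'cV[R]_p) :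
    'M[R]_(n + (m + p), n * m + (m * p + (n + p))) :=
  col_mx
    (row_mx (a1^-1 *: (Nmx n y *m Phi B))
    (row_mx 0
    (row_mx (- (a3^-1 *: 1%:M)) 0)))
 (col_mx
    (row_mx (a1^-1 *: (Mmx m r *m Phi B))
    (row_mx (a2^-1 *: (Nmx m l *m Phi D))
    (row_mx 0 0)))
    (row_mx 0
    (row_mx (a2^-1 *: (Mmx p y *m Phi D))
    (row_mx 0 (- (a4^-1 *: 1%:M)))))).

Definition Rhat (B : 'M[R]_(m, n)) (D : 'M[R]_(p, m))
    (f : 'cV[R]_n) (h : 'cV[R]_p)
    (r : 'cV[R]_n) (y : 'cV[R]_m) (l : 'cV[R]_p) : 'cV[R]_(n + (m + p)) :=
  vec3 (f - r - B^T *m y) (- (B *m r) - D^T *m l) (h - D *m y).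

End LSE.

(* Main.v *)
(** Stack a perturbation t = (dB, dD, df, dh) into the weighted vector
    E t = (a1 vec dB, a2 vec dD, a3 df, a4 dh), so that the size of t is the
    Euclidean norm of E t; for a sparse t, membership in G means J E t = R.
    The rank hypothesis makes J x = R consistent, and z = J^+ R is its solution
    of least norm, which bounds every admissible size from below. Conversely,
    write z = E t and let t' be t with the entries outside the patterns
    replaced by 0: J only sees the entries in the patterns, so J E t' = R, and
    |E t'| <= |z|, hence t' attains the bound. *)

Require Import Defs.
From HB Require Import structures.
From mathcomp Require Import all_boot all_order all_algebra.
From mathcomp Require Import boolp classical_sets reals.

Import Order.TTheory GRing.Theory Num.Theory.
Local Open Scope ring_scope.

Section ColumnVectorization.
Context {R : realType}.

Lemma sum_mxvec_index (V : nmodType) m n (F : 'I_(m * n) -> V) :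
  \sum_k F k = \sum_i \sum_j F (mxvec_index i j).
Proof.
rewrite pair_bigA /= (reindex (uncurry (@mxvec_index m n))) /=; last first.
  exact: curry_mxvec_bij.
by apply: eq_bigr => -[].
Qed.

(** The inner transpose turns the row-major [mxvec] into column stacking, so block [j] is column [j]
    of [X], in the layout of [Phi], [Mmx] and [Nmx]. *)
Definition cvec {m n} (X : 'M[R]_(m, n)) : 'cV[R]_(n * m) := (mxvec X^T)^T.

Definition uncvec {m n} (u : 'cV[R]_(n * m)) : 'M[R]_(m, n) := (vec_mx u^T)^T.

Lemma uncvecK m n : cancel (@uncvec m n) (@cvec m n).
Proof. by move=> u; rewrite /cvec /uncvec trmxK vec_mxK trmxK. Qed.

(** Row [i] of [Nmx n y] meets only block [i], that is column [i] of [X]. Here and in [Mmx_cvec] the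
    unknown moves from the matrix factor to the vector factor. *)
Lemma Nmx_cvec m n (y : 'cV[R]_m) (X : 'M[R]_(m, n)) :
  Nmx n y *m cvec X = X^T *m y.
Proof.
apply/colP => i; rewrite !mxE sum_mxvec_index.
rewrite (bigD1 i) //= [X in _ + X]big1 ?addr0; last first.
  move=> j /negbTE ji; apply: big1 => k _.
  by rewrite !mxE !mxvecE !mxE eq_sym ji mul0r.
by apply: eq_bigr => k _; rewrite !mxE !mxvecE !mxE eqxx mulrC.
Qed.

Lemma Mmx_cvec m n (x : 'cV[R]_n) (X : 'M[R]_(m, n)) :
  Mmx m x *m cvec X = X *m x.
Proof.
apply/colP => i; rewrite !mxE sum_mxvec_index; apply: eq_bigr => j _.
rewrite (bigD1 i) //= big1 ?addr0; last first.
  by move=> k /negbTE ki; rewrite !mxE !mxvecE !mxE eq_sym ki mulr0 mul0r.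
by rewrite !mxE !mxvecE !mxE eqxx mulr1 mulrC.
Qed.

Lemma Phi_cvec m n (B X : 'M[R]_(m, n)) :
  Phi B *m cvec X = cvec (hadamard X (Theta B)).
Proof.
apply/colP => k; rewrite mul_diag_mx; case/mxvec_indexP: k => i j.
by rewrite !mxE !mxvecE !mxE mulrC.
Qed.

Lemma hadamard_Theta_idem m n (X B : 'M[R]_(m, n)) :
  hadamard (hadamard X (Theta B)) (Theta B) = hadamard X (Theta B).
Proof.
by apply/matrixP => i j; rewrite !mxE -mulrA -natrM mulnb andbb.
Qed.

End ColumnVectorization.

Section FrobeniusNorm.
Context {R : realType}.

Lemma fnorm_ge0 m n (A : 'M[R]_(m, n)) : 0 <= fnorm A.
Proof. exact: sqrtr_ge0. Qed.

Lemma sqr_fnorm m n (A : 'M[R]_(m, n)) :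
  fnorm A ^+ 2 = \sum_i \sum_j A i j ^+ 2.
Proof.
by rewrite sqr_sqrtr // sumr_ge0 // => i _; apply: sumr_ge0 => j _; exact: sqr_ge0.
Qed.

Lemma sqr_fnorm_col_mx m1 m2 n (A : 'M[R]_(m1, n)) (B : 'M[R]_(m2, n)) :
  fnorm (col_mx A B) ^+ 2 = fnorm A ^+ 2 + fnorm B ^+ 2.
Proof.
rewrite !sqr_fnorm big_split_ord /=; congr (_ + _);
  by apply: eq_bigr => i _; apply: eq_bigr => j _; rewrite (col_mxEu, col_mxEd).
Qed.

Lemma sqr_fnormZ m n a (A : 'M[R]_(m, n)) :
  fnorm (a *: A) ^+ 2 = a ^+ 2 * fnorm A ^+ 2.
Proof.
rewrite !sqr_fnorm mulr_sumr; apply: eq_bigr => i _; rewrite mulr_sumr.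
by apply: eq_bigr => j _; rewrite mxE exprMn.
Qed.

Lemma sqr_fnorm_cvec m n (X : 'M[R]_(m, n)) : fnorm (cvec X) ^+ 2 = fnorm X ^+ 2.
Proof.
rewrite !sqr_fnorm sum_mxvec_index exchange_big; apply: eq_bigr => i _.
by apply: eq_bigr => j _; rewrite big_ord1 mxE mxvecE mxE.
Qed.

Lemma sqr_fnorm_hadamard_Theta_le m n (X B : 'M[R]_(m, n)) :
  fnorm (hadamard X (Theta B)) ^+ 2 <= fnorm X ^+ 2.
Proof.
rewrite !sqr_fnorm; apply: ler_sum => i _; apply: ler_sum => j _.
by rewrite !mxE; case: (B i j != 0); rewrite ?mulr1 // mulr0 expr0n sqr_ge0.
Qed.

Lemma sqr_fnorm_cV n (u : 'cV[R]_n) : fnorm u ^+ 2 = (u^T *m u) 0 0.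
Proof.
by rewrite sqr_fnorm mxE; apply: eq_bigr => i _; rewrite big_ord1 mxE expr2.
Qed.

End FrobeniusNorm.

Section MinimumNormSolution.
Context {R : realType}.

(** After transposition, the row space of [A^T] lies in that of [A^T] extended by [b^T]; equal ranks
    force equality, so [b^T] is a combination of rows of [A^T]. *)
Lemma rank_consistent m n (A : 'M[R]_(m, n)) (b : 'cV[R]_m) :
  \rank A = \rank (row_mx A b) -> exists x, A *m x = b.
Proof.
rewrite -mxrank_tr -[RHS]mxrank_tr tr_row_mx => rkE.
have : (A^T == col_mx A^T b^T)%MS.
  by rewrite -(geq_leqif (mxrank_leqif_eq _)) ?rkE // -addsmxE addsmxSl.
case/andP=> _; rewrite col_mx_sub => /andP[_ /submxP[x bE]].
by exists x^T; rewrite -[A]trmxK -trmx_mul -bE trmxK.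
Qed.

Lemma pinv_solution {m n} (A : 'M[R]_(m, n)) (x : 'cV[R]_n) :
  A *m (pinv A *m (A *m x)) = A *m x.
Proof. by have [AXA _ _ _] := pinvP A; rewrite !mulmxA AXA. Qed.

(* [pinv A *m A] is an orthogonal projection. *)
Lemma pinv_min_norm m n (A : 'M[R]_(m, n)) (x : 'cV[R]_n) :
  fnorm (pinv A *m (A *m x)) <= fnorm x.
Proof.
have [_ XAX _ tXA] := pinvP A; rewrite mulmxA.
have : pinv A *m A *m (pinv A *m A) = pinv A *m A by rewrite mulmxA XAX.
move: (pinv A *m A) tXA => Q tXA QQ.
rewrite -ler_sqr ?nnegrE ?fnorm_ge0 //.
suff -> : fnorm x ^+ 2 = fnorm (Q *m x) ^+ 2 + fnorm (x - Q *m x) ^+ 2.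
  by rewrite lerDl sqr_ge0.
rewrite !sqr_fnorm_cV [(x - _)^T]linearB /= trmx_mul tXA mulmxBl !mulmxBr.
rewrite !mulmxA -(mulmxA _ Q Q) QQ subrr subr0.
by rewrite [X in _ + X]mxE [X in _ + (_ + X)]mxE addrC subrK.
Qed.

End MinimumNormSolution.

(** Needed because [eta_sps] is an infimum; [x] witnesses both that [E] is bounded below and that it
    is nonempty. *)
Lemma inf_minimum {R : realType} (E : set R) x : is_minimum E x -> inf E = x.
Proof.
move=> [Ex lbx]; apply/eqP; rewrite eq_le; apply/andP; split.
  by apply: ge_inf => //; exists x.
by apply: lb_le_inf => //; exists x.
Qed.

Section LSE.
Context {R : realType} {m n p : nat}.
Variables (B : 'M[R]_(m, n)) (D : 'M[R]_(p, m)).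
Variables (f : 'cV[R]_n) (h : 'cV[R]_p).
Variables (r : 'cV[R]_n) (y : 'cV[R]_m) (l : 'cV[R]_p).
Variables (a1 a2 a3 a4 : R).
Hypotheses (a1n0 : a1 != 0) (a2n0 : a2 != 0) (a3n0 : a3 != 0) (a4n0 : a4 != 0).

Let J := J_G a1 a2 a3 a4 B D r y l.

Definition weighted_vec (t : @perturbation R m n p) :
    'cV[R]_(n * m + (m * p + (n + p))) :=
  let: (dB, dD, df, dh) := t in
  col_mx (a1 *: cvec dB) (col_mx (a2 *: cvec dD) (col_mx (a3 *: df) (a4 *: dh))).

(** The projection onto the sparsity-preserving perturbations, which are its fixed points. *)
Definition sparsify (t : @perturbation R m n p) : @perturbation R m n p :=
  let: (dB, dD, df, dh) := t in
  (hadamard dB (Theta B), hadamard dD (Theta D), df, dh).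

Lemma preserves_sparsityP t : preserves_sparsity B D t <-> t = sparsify t.
Proof.
case: t => [[[dB dD] df] dh]; split=> [[eB eD]|[eB eD]]; last by split.
by rewrite /= -eB -eD.
Qed.

Lemma sparsify_idem t : sparsify (sparsify t) = sparsify t.
Proof. by case: t => [[[dB dD] df] dh] /=; rewrite !hadamard_Theta_idem. Qed.

Lemma weighted_vec_surj z : exists t, weighted_vec t = z.
Proof.
exists (uncvec (a1^-1 *: usubmx z), uncvec (a2^-1 *: usubmx (dsubmx z)),
  a3^-1 *: usubmx (dsubmx (dsubmx z)), a4^-1 *: dsubmx (dsubmx (dsubmx z))).
by rewrite /= !uncvecK !scalerA !divff // !scale1r !vsubmxK.
Qed.

Lemma sqr_fnorm_weighted_vec dB dD df dh :
  fnorm (weighted_vec (dB, dD, df, dh)) ^+ 2 =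
  a1 ^+ 2 * fnorm dB ^+ 2 + a2 ^+ 2 * fnorm dD ^+ 2
  + a3 ^+ 2 * fnorm df ^+ 2 + a4 ^+ 2 * fnorm dh ^+ 2.
Proof. by rewrite !sqr_fnorm_col_mx !sqr_fnormZ !sqr_fnorm_cvec !addrA. Qed.

Lemma pert_sizeE t : pert_size a1 a2 a3 a4 t = fnorm (weighted_vec t).
Proof.
case: t => [[[dB dD] df] dh]; rewrite [LHS]/= -sqr_fnorm_weighted_vec.
by rewrite sqrtr_sqr ger0_norm // fnorm_ge0.
Qed.

Lemma fnorm_sparsify_le t :
  fnorm (weighted_vec (sparsify t)) <= fnorm (weighted_vec t).
Proof.
case: t => [[[dB dD] df] dh]; rewrite -ler_sqr ?nnegrE ?fnorm_ge0 //.
rewrite !sqr_fnorm_weighted_vec !lerD //;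
  by rewrite ler_wpM2l ?sqr_ge0 ?sqr_fnorm_hadamard_Theta_le.
Qed.

(** The weights cancel the inverse factors in [J_G], and the [Phi] factors mask the matrices. What
    remains is the change that the masked perturbation makes in each block equation. *)
Lemma J_weighted_vec dB dD df dh :
  let dB' := hadamard dB (Theta B) in
  let dD' := hadamard dD (Theta D) in
  J *m weighted_vec (dB, dD, df, dh) =
  vec3 (dB'^T *m y - df) (dB' *m r + dD'^T *m l) (dD' *m y - dh).
Proof.
rewrite /= /J /J_G /weighted_vec !mul_col_mx !mul_row_col !mul0mx !add0r !addr0.
rewrite !mulNmx -!scalemxAl -!scalemxAr !scalerA !mulVf // !scale1r !mul1mx.
by rewrite -!mulmxA !Phi_cvec !Nmx_cvec !Mmx_cvec.
Qed.

Lemma J_sparsify t : J *m weighted_vec (sparsify t) = J *m weighted_vec t.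
Proof.
by case: t => [[[dB dD] df] dh]; rewrite !J_weighted_vec !hadamard_Theta_idem.
Qed.

(** Masking fixes [t], so each block of the perturbed system is the matching block of
    [J *m weighted_vec t = Rhat] once the unperturbed terms are moved to the right. *)
Lemma GsetP t : t = sparsify t ->
  Gset B D f h r y l t <-> J *m weighted_vec t = Rhat B D f h r y l.
Proof.
case: t => [[[dB dD] df] dh] [eB eD]; rewrite J_weighted_vec -eB -eD.
rewrite /Gset /aug_mx /Rhat /vec3 /= !mul_col_mx !mul_row_col.
rewrite !mul0mx !mul1mx !add0r !addr0 !linearD /= !mulmxDl.
(* [E1], [E2] and [E3] are these rearrangements for the three block rows; as equalities of booleans
   they serve both directions. *)
have E1 (V : zmodType) (a b c u v : V) :
    (a + (b + c) == u + v) = (c - v == u - a - b).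
  rewrite -subr_eq0 -[RHS]subr_eq0 !opprD !opprK !addrA.
  by rewrite [in RHS](ACl (4*5*1*3*2)).
have E2 (V : zmodType) (a b c d : V) :
    (a + c + (b + d) == 0) = (c + d == - a - b).
  by rewrite -[RHS]subr_eq0 !opprD !opprK !addrA [in RHS](ACl (3*1*4*2)).
have E3 (V : zmodType) (b c u v : V) :
    (b + c == u + v) = (c - v == u - b).
  rewrite -subr_eq0 -[RHS]subr_eq0 !opprD !opprK !addrA.
  by rewrite [in RHS](ACl (4*1*3*2)).
split=> /eq_col_mx[e1 /eq_col_mx[e2 e3]]; congr (col_mx _ (col_mx _ _)).
- by apply/eqP; rewrite -E1; apply/eqP.
- by apply/eqP; rewrite -E2; apply/eqP.
- by apply/eqP; rewrite -E3; apply/eqP.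
- by apply/eqP; rewrite E1; apply/eqP.
- by apply/eqP; rewrite E2; apply/eqP.
- by apply/eqP; rewrite E3; apply/eqP.
Qed.

Lemma backward_error_minimum :
  \rank J = \rank (row_mx J (Rhat B D f h r y l)) ->
  is_minimum (sps_sizes a1 a2 a3 a4 B D f h r y l)
    (fnorm (pinv J *m Rhat B D f h r y l)).
Proof.
case/rank_consistent => x Jx.
(* For admissible [t], the right-hand side is [J *m weighted_vec t], so the candidate is the
   projection of [weighted_vec t] by [pinv J *m J]. *)
have minz t : (Gset B D f h r y l `&` preserves_sparsity B D)%classic t ->
    fnorm (pinv J *m Rhat B D f h r y l) <= pert_size a1 a2 a3 a4 t.
  case=> Gt /preserves_sparsityP/GsetP/iffLR/(_ Gt) <-.
  by rewrite pert_sizeE pinv_min_norm.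
have [t tz] := weighted_vec_surj (pinv J *m Rhat B D f h r y l).
have Gs : (Gset B D f h r y l `&` preserves_sparsity B D)%classic (sparsify t).
  split; last by apply/preserves_sparsityP; rewrite sparsify_idem.
  apply/GsetP; first by rewrite sparsify_idem.
  by rewrite J_sparsify tz -Jx pinv_solution.
split; last by move=> _ [u Gu <-]; exact: minz.
(* The size is squeezed: [minz] bounds it below, and masking cannot increase the norm of
   [weighted_vec t]. *)
exists (sparsify t) => //; apply/eqP; rewrite eq_le minz // andbT.
by rewrite pert_sizeE -tz fnorm_sparsify_le.
Qed.

End LSE.

Theorem theorem6p1 (R : realType) (m n p : nat)
    (B : 'M[R]_(m, n)) (D : 'M[R]_(p, m)) (f : 'cV[R]_n) (h : 'cV[R]_p)
    (r : 'cV[R]_n) (y : 'cV[R]_m) (l : 'cV[R]_p)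
    (a1 a2 a3 a4 : R)
    (ha1 : 0 < a1) (ha2 : 0 < a2) (ha3 : 0 < a3) (ha4 : 0 < a4)
    (hrank : \rank (J_G a1 a2 a3 a4 B D r y l) =
             \rank (row_mx (J_G a1 a2 a3 a4 B D r y l) (Rhat B D f h r y l))) :
  is_minimum (sps_sizes a1 a2 a3 a4 B D f h r y l)
             (eta_sps a1 a2 a3 a4 B D f h r y l) /\
  eta_sps a1 a2 a3 a4 B D f h r y l =
    fnorm (pinv (J_G a1 a2 a3 a4 B D r y l) *m Rhat B D f h r y l).
Proof.
have min_z := backward_error_minimum _ _ _ _ _ _ _ _ _ _ _
  (lt0r_neq0 ha1) (lt0r_neq0 ha2) (lt0r_neq0 ha3) (lt0r_neq0 ha4) hrank.
by rewrite /eta_sps (inf_minimum _ _ min_z).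
Qed.
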